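(* Let $(R,M)$ be a local Artinian ring such that $R/M$ is infinite and let $R\subseteq S$ be a ring extension. Then: (1) If $R\subset S$ has FIP and is subintegral, then $[R,S]$ is linearly ordered by inclusion. (2) If $R\subseteq S$ is module-finite, seminormal and infra-integral, then $R\subseteq S$ has FIP. (3) If $R\subset S$ is module-finite and infra-integral, then $R\subset S$ has FIP if and only if $R\subseteq{}^{+}_{S}R$ has FIP, where ${}^{+}_{S}R$ denotes the seminormalization of $R$ in $S$.
   Context: All rings are commutative, unital and nonzero; $\subset$ denotes proper inclusion. For a ring extension $R\subseteq S$, $[R,S]$ is the set of all $R$-subalgebras of $S$; the extension has FIP if $[R,S]$ is finite. An integral extension $R\subseteq S$ is infra-integral if all its residual field extensions $\kappa(Q\cap R)\to\kappa(Q)$, $Q\in\mathrm{Spec}(S)$, are isomorphisms; it is subintegral if it is infra-integral and $\mathrm{Spec}(S)\to\mathrm{Spec}(R)$ is bijective. $R\subseteq S$ is seminormal if $b\in S$ and $b^2,b^3\in R$ imply $b\in R$. The seminormalization of $R$ in $S$ is the smallest $B\in[R,S]$ such that $B\subseteq S$ is seminormal. *)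

(* Defs.v *)
From HB Require Import structures.
From mathcomp Require Import all_boot all_order all_algebra.
From mathcomp Require Import ring_quotient generic_quotient fraction.
From mathcomp Require Import boolp classical_sets functions cardinality.

Set Implicit Arguments.
Unset Strict Implicit.
Unset Printing Implicit Defensive.

Import GRing.Theory.
Local Open Scope classical_set_scope.
Local Open Scope ring_scope.
Local Open Scope quotient_scope.

(* Ideals are sets of R that are submodules of the regular module R^o; the    *)
(* unit ideal is allowed, whereas the library's [idealr R] and                *)
(* [prime_idealr R] consist of proper ideals only.                            *)
Definition is_ideal (R : comNzRingType) (I : set R) : Prop :=
  submod_closed (mem (I : set R^o)).

Definition artinian (R : comNzRingType) : Prop :=
  forall I : nat -> set R,
    (forall n, is_ideal (I n)) -> (forall n, I n.+1 `<=` I n) ->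
  exists N, forall n, (N <= n)%N -> I n = I N.

Definition maximal_ideal (R : comNzRingType) (I : idealr R) : Prop :=
  forall J : idealr R, {subset I <= J} -> J =i I.

Definition local_ring (R : comNzRingType) (M : idealr R) : Prop :=
  maximal_ideal M /\ forall N : idealr R, maximal_ideal N -> N =i M.

(* Leibniz equality on [prime_idealr R] is extensional equality, by           *)
(* [spec_ext] below, so that bijectivity between spectra has its usual        *)
(* meaning.                                                                   *)
Notation Spec := prime_idealr.

Lemma spec_ext (R : comNzRingType) (P Q : Spec R) : P =i Q -> P = Q.
Proof.
case: P Q => [P cP] [Q cQ] /= PQ.
have {PQ} eqPQ : P = Q by apply/funext => x; exact: PQ.
case: Q / eqPQ cQ => cQ; congr (PrimeIdealr.Pack _).
case: cP cQ => [[a] [b] [c] [d]] [[a'] [b'] [c'] [d']].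
by rewrite (Prop_irrelevance a a') (Prop_irrelevance b b')
  (Prop_irrelevance c c') (Prop_irrelevance d d').
Qed.

(* The integral domain R / P; its units are decided classically.              *)
Section ResidueDomain.
Variables (R : comNzRingType) (P : Spec R).

Definition residue_dom : Type := {ideal_quot P}.

HB.instance Definition _ := GRing.ComNzRing.on residue_dom.

Definition residue_unit : pred residue_dom := fun x => `[< exists y, y * x = 1 >].
Definition residue_inv (x : residue_dom) : residue_dom :=
  xget x [set y | y * x = 1].

Fact residue_mulVx : {in residue_unit, left_inverse 1 residue_inv *%R}.
Proof.
move=> x /asboolP[y yx]; rewrite /residue_inv.
by case: xgetP => [z _ //|/(_ y)].
Qed.

Fact residue_unitP (x y : residue_dom) : y * x = 1 -> residue_unit x.
Proof. by move=> yx; apply/asboolP; exists y. Qed.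

Fact residue_inv_out : {in [predC residue_unit], residue_inv =1 id}.
Proof.
move=> x /negP nx; rewrite /residue_inv; case: xgetP => // y _ yx.
by case: nx; exact: (residue_unitP yx).
Qed.

HB.instance Definition _ := GRing.ComNzRing_hasMulInverse.Build residue_dom
  residue_mulVx residue_unitP residue_inv_out.
HB.instance Definition _ := GRing.ComUnitRing_isIntegral.Build residue_dom
  (@Quotient.rquot_IdomainAxiom R P).

Definition residue_proj (x : R) : residue_dom := \pi_{ideal_quot P} x.

Fact residue_proj_is_zmod_morphism : zmod_morphism residue_proj.
Proof. exact: (@rmorphB _ _ (\pi_{ideal_quot P})). Qed.
Fact residue_proj_is_monoid_morphism : monoid_morphism residue_proj.
Proof. exact: pi_is_monoid_morphism. Qed.
HB.instance Definition _ := GRing.isZmodMorphism.Build R residue_dom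
  residue_proj residue_proj_is_zmod_morphism.
HB.instance Definition _ := GRing.isMonoidMorphism.Build R residue_dom
  residue_proj residue_proj_is_monoid_morphism.

Lemma residue_proj_eq (x y : R) :
  (residue_proj x == residue_proj y) = (x - y \in P).
Proof. by rewrite Quotient.idealrBE. Qed.

Lemma residue_projK (x : residue_dom) : residue_proj (repr x) = x.
Proof. exact: (@reprK _ {ideal_quot P}). Qed.

Definition residue_field : fieldType := {fraction residue_dom}.

Definition to_residue_field (x : R) : residue_field :=
  FracField.tofrac (residue_proj x).

End ResidueDomain.

Lemma fracE (D : idomainType) (x : {fraction D}) :
  x = FracField.tofrac \n_(repr x) / FracField.tofrac \d_(repr x).
Proof.
have d0 : \d_(repr x) != 0 by exact: denom_ratioP.
apply: (canRL (mulfK _)); rewrite ?tofrac_eq0//.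
rewrite -[x in x * _](@reprK _ (FracField.type D)).
set r := repr x in d0 *; unlock FracField.tofrac.
rewrite -[LHS]FracField.pi_mul; apply/eqP.
rewrite FracField.equivf_def /FracField.mulf !numden_Ratio ?mulf_neq0 ?oner_neq0//.
by rewrite !mulr1 mulrC.
Qed.

Section Contraction.
Variables (R S : comNzRingType) (f : {rmorphism R -> S}).

Definition contract_pred (Q : Spec S) : pred R := fun r => f r \in Q.

Fact contract_idealr Q : idealr_closed (contract_pred Q).
Proof.
split=> [||a u v].
- by rewrite -topredE /= /contract_pred rmorph0 idealr0.
- by rewrite -topredE /= /contract_pred rmorph1 idealr1.
- rewrite -!topredE /= /contract_pred => uQ vQ.
  by rewrite rmorphD rmorphM rpredD ?idealMr.
Qed.
Fact contract_prime Q : prime_idealr_closed (contract_pred Q).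
Proof.
by move=> u v; rewrite -!topredE /= /contract_pred rmorphM prime_idealrM.
Qed.
HB.instance Definition _ Q := isIdealr.Build R (contract_pred Q) (contract_idealr Q).
HB.instance Definition _ Q :=
  isPrimeIdealrClosed.Build R (contract_pred Q) (@contract_prime Q).

Definition contract (Q : Spec S) : Spec R := contract_pred Q.

Definition residue_dom_map (Q : Spec S) (x : residue_dom (contract Q)) :
  residue_dom Q := residue_proj Q (f (repr x)).

(* The map kappa(f^-1 Q) -> kappa(Q) induced by f; it is a ring morphism, and *)
(* [residue_mapE] characterizes it.                                           *)
Definition residue_map (Q : Spec S) (x : residue_field (contract Q)) :
    residue_field Q :=
  FracField.tofrac (residue_dom_map (\n_(repr x))) /
  FracField.tofrac (residue_dom_map (\d_(repr x))).

Lemma residue_dom_mapE Q r :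
  residue_dom_map (residue_proj (contract Q) r) = residue_proj Q (f r).
Proof.
apply/eqP; rewrite residue_proj_eq -rmorphB.
by have /eqP := residue_projK (residue_proj (contract Q) r); rewrite residue_proj_eq.
Qed.

Lemma residue_dom_map_is_zmod_morphism Q : zmod_morphism (@residue_dom_map Q).
Proof.
move=> x y; rewrite -[x]residue_projK -[y]residue_projK.
by rewrite -rmorphB !residue_dom_mapE !rmorphB.
Qed.
Lemma residue_dom_map_is_monoid_morphism Q :
  monoid_morphism (@residue_dom_map Q).
Proof.
split=> [|x y].
  by rewrite -(rmorph1 (residue_proj (contract Q))) residue_dom_mapE !rmorph1.
rewrite -[x]residue_projK -[y]residue_projK.
by rewrite -rmorphM !residue_dom_mapE !rmorphM.
Qed.
HB.instance Definition _ Q := GRing.isZmodMorphism.Build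
  (residue_dom (contract Q)) (residue_dom Q) (@residue_dom_map Q)
  (@residue_dom_map_is_zmod_morphism Q).
HB.instance Definition _ Q := GRing.isMonoidMorphism.Build
  (residue_dom (contract Q)) (residue_dom Q) (@residue_dom_map Q)
  (@residue_dom_map_is_monoid_morphism Q).

Lemma residue_dom_map_eq0 Q x : (@residue_dom_map Q x == 0) = (x == 0).
Proof.
rewrite -[x]residue_projK residue_dom_mapE.
by rewrite -(rmorph0 (residue_proj Q)) -(rmorph0 (residue_proj (contract Q)))
  !residue_proj_eq !subr0.
Qed.

Lemma residue_map_frac Q (a b : residue_dom (contract Q)) : b != 0 ->
  residue_map (FracField.tofrac a / FracField.tofrac b) =
  FracField.tofrac (residue_dom_map a) / FracField.tofrac (residue_dom_map b).
Proof.
move=> b0; rewrite /residue_map.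
set z := repr _; have z0 : \d_z != 0 by exact: denom_ratioP.
have /eqP : FracField.tofrac \n_z / FracField.tofrac \d_z =
    FracField.tofrac a / FracField.tofrac b :> residue_field (contract Q).
  by rewrite -fracE.
rewrite eqr_div ?tofrac_eq0// -!tofracM tofrac_eq => /eqP nd.
apply/eqP; rewrite eqr_div ?tofrac_eq0 ?residue_dom_map_eq0//.
by rewrite -!tofracM -!rmorphM nd.
Qed.

Lemma residue_mapE Q r :
  residue_map (to_residue_field (contract Q) r) = to_residue_field Q (f r).
Proof.
rewrite -[to_residue_field _ r]divr1 -tofrac1 residue_map_frac ?oner_neq0//.
by rewrite residue_dom_mapE rmorph1 tofrac1 divr1.
Qed.

Lemma residue_map_is_zmod_morphism Q : zmod_morphism (@residue_map Q).
Proof.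
move=> x y; rewrite (fracE x) (fracE y).
have dx : \d_(repr x) != 0 by exact: denom_ratioP.
have dy : \d_(repr y) != 0 by exact: denom_ratioP.
rewrite -mulNr addf_div ?tofrac_eq0// -tofracN -!tofracM -tofracD.
rewrite !residue_map_frac ?mulf_neq0// -[in RHS]mulNr.
rewrite [RHS]addf_div ?tofrac_eq0 ?residue_dom_map_eq0//.
by rewrite -tofracN -!tofracM -tofracD rmorphD !rmorphM rmorphN.
Qed.

Lemma residue_map_is_monoid_morphism Q : monoid_morphism (@residue_map Q).
Proof.
split=> [|x y].
  rewrite -[1 in LHS]divr1 -tofrac1 residue_map_frac ?oner_neq0//.
  by rewrite rmorph1 tofrac1 divr1.
rewrite (fracE x) (fracE y).
have dx : \d_(repr x) != 0 by exact: denom_ratioP.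
have dy : \d_(repr y) != 0 by exact: denom_ratioP.
rewrite mulf_div -!tofracM !residue_map_frac ?mulf_neq0//.
by rewrite mulf_div -!tofracM !rmorphM.
Qed.

HB.instance Definition _ Q := GRing.isZmodMorphism.Build
  (residue_field (contract Q)) (residue_field Q) (@residue_map Q)
  (@residue_map_is_zmod_morphism Q).
HB.instance Definition _ Q := GRing.isMonoidMorphism.Build
  (residue_field (contract Q)) (residue_field Q) (@residue_map Q)
  (@residue_map_is_monoid_morphism Q).

End Contraction.

(* A ring extension of R is a commutative R-algebra S with injective          *)
(* [GRing.in_alg S]; the copy of R inside S is [range (GRing.in_alg S)], and  *)
(* the R-subalgebras of S are subsets of S.                                   *)
Section Extensions.
Variables (R : comNzRingType) (S : comAlgType R).

Definition ring_extension : Prop := injective (GRing.in_alg S).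

Definition base_ring : set S := range (GRing.in_alg S).

Definition proper_extension : Prop := ring_extension /\ base_ring `<` [set: S].

Definition subalg (A : set S) : Prop := subalg_closed (mem A).

(* [R, B], for B an R-subalgebra of S *)
Definition intermediate (B : set S) : set (set S) :=
  [set A | subalg A /\ A `<=` B].

Definition FIP (B : set S) : Prop := finite_set (intermediate B).

Definition integral_extension : Prop := integralRange (GRing.in_alg S).

Definition infra_integral : Prop :=
  integral_extension /\
  forall Q : Spec S, bijective (@residue_map R S (GRing.in_alg S) Q).

Definition subintegral : Prop :=
  infra_integral /\ bijective (@contract R S (GRing.in_alg S)).

Definition module_finite : Prop :=
  exists (n : nat) (g : 'I_n -> S),
    forall s, exists c : 'I_n -> R, s = \sum_(i < n) c i *: g i.

(* B is seminormal in S *)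
Definition seminormal (B : set S) : Prop :=
  forall b : S, B (b ^+ 2) -> B (b ^+ 3) -> B b.

Definition seminormalization : set S :=
  smallest [set B | subalg B /\ seminormal B] set0.

Lemma seminormalizationP :
  [/\ subalg seminormalization, seminormal seminormalization &
      forall B, subalg B -> seminormal B -> seminormalization `<=` B].
Proof.
have memE (A : set S) x : (x \in mem A) = (x \in A) by [].
split.
- split=> [|a u v|u v]; rewrite !memE.
  + by apply/mem_set => B [[[+ _ _] _] _]; rewrite memE => /set_mem.
  + move=> /set_mem uN /set_mem vN; apply/mem_set => B BP.
    have [[[_ BL _] _] _] := BP; apply: set_mem.
    by apply: BL; rewrite memE; apply/mem_set; [exact: uN|exact: vN].
  + move=> /set_mem uN /set_mem vN; apply/mem_set => B BP.
    have [[[_ _ BM] _] _] := BP; apply: set_mem.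
    by apply: BM; rewrite memE; apply/mem_set; [exact: uN|exact: vN].
- move=> b b2 b3 B BP; have [[_ Bsn] _] := BP.
  by apply: Bsn; [exact: b2|exact: b3].
- by move=> B Bsub Bsn; apply: smallest_sub.
Qed.

End Extensions.

Arguments ring_extension {R} S.
Arguments base_ring {R} S.
Arguments proper_extension {R} S.
Arguments integral_extension {R} S.
Arguments infra_integral {R} S.
Arguments subintegral {R} S.
Arguments module_finite {R} S.
Arguments seminormalization {R} S.

(* Main.v *)
Require Import Defs.
From HB Require Import structures.
From mathcomp Require Import all_boot all_order all_algebra.
From mathcomp Require Import ring_quotient.
From mathcomp Require Import boolp classical_sets cardinality.
From mathcomp Require Import ring zify.

(** Everything rests on one principle: a multiplicative subset of S that meets
    every prime of S contains 0 ([prime_avoiding]).  The ring R being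
    Artinian and local, M is its only prime, and infra-integrality of S implies
    that for every prime Q of S each x in S is congruent modulo Q to some r in R
    ([infra_integral_rational]).  Feeding suitable multiplicative sets to the
    principle gives, for each x in S, a relation [prod_j (x - r_j) = 0] with the
    r_j in R ([rational_split]), and strong pi-regularity
    [x ^ n = x ^ n.+1 * w] with w in any prescribed subalgebra containing x
    ([strongly_pi_regular]).

    Finiteness.  Pi-regularity produces Fitting idempotents inside each
    subalgebra A, and with the split relation it writes each element of A as an
    R-combination of idempotents of A plus a nilpotent of A.  So A is determined
    by its idempotents and its nilpotents ([sub_of_idempotents_nilpotents]).
    If T is a subalgebra that is seminormal in S, descending through the powers
    of a nilpotent element puts it into T, so that A is determined by its
    idempotents and by its intersection with T.  When S is module-finite it has
    finitely many idempotents: a prime is known once a root r_j has been chosen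
    for each module generator, and an idempotent is known from the primes
    containing it ([idempotents_finite]).  Hence FIP for [R, T] implies FIP for
    [R, S] ([FIP_of_seminormal]).  Take T = R for the second claim and T the
    seminormalization for the third.

    Chains.  In the subintegral case S has a single prime, so S is R plus
    nilpotents.  Two incomparable subalgebras A and B would provide nilpotent
    elements a in A but not in B, and b in B but not in A.  As R / M is infinite
    and there are finitely many subalgebras, two of the algebras R[a + r b]
    coincide, and their common value R[c] contains a and b ([FIP_line]).  Write
    a = p(c) and b = q(c).  The cotangent space of R[c] over R / M is spanned by
    c, so if the linear coefficient of p or of q is a unit then a or b alone
    generates R[c]; if neither is, then a + r b = c forces R[c] = R.  Each
    alternative contradicts the choice of a and b
    ([adjoin_line_disjunction]). *)

Set Implicit Arguments.
Unset Strict Implicit.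
Unset Printing Implicit Defensive.

Local Open Scope classical_set_scope.
Local Open Scope ring_scope.
Import GRing.Theory.

(** * Primes avoiding a multiplicative set *)

Definition multiplicative (S : comNzRingType) (U : set S) : Prop :=
  U 1 /\ forall u v, U u -> U v -> U (u * v).

Lemma spec_of_set (S : comNzRingType) (I : set S) :
    idealr_closed [pred x | `[< I x >]] ->
    prime_idealr_closed [pred x | `[< I x >]] ->
  exists P : Spec S, forall x, (x \in P) <-> I x.
Proof.
move=> Iid Ipr.
pose J : S -> bool := [pred x | `[< I x >]].
pose P : Spec S := HB.pack_for (prime_idealr S) J
  (isIdealr.Build S J Iid) (isPrimeIdealrClosed.Build S J Ipr).
by exists P => x; split=> /asboolP.
Qed.

(** Krull: a set that is maximal among the ideals disjoint from U is prime. *)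
Lemma prime_avoiding (S : comNzRingType) (U : set S) :
    multiplicative U -> ~ U 0 ->
  exists P : Spec S, forall x, U x -> x \notin P.
Proof.
move=> [U1 UM] U0.
pose ideal_avoiding (I : set S) :=
  (forall a u v, I u -> I v -> I (a * u + v)) /\ (forall x, U x -> ~ I x).
(* The empty set is allowed here because the union of the empty chain has to *)
(* qualify; the maximal element contains 0 all the same.                     *)
have [F FP Ftot|I [[IL IU] Imax]] := @Zorn_bigcup S ideal_avoiding.
  split=> [a u v [X FX Xu] [Y FY Yv]|x Ux [X FX Xx]]; last first.
    by have [_ /(_ x Ux)] := FP X FX.
  have [XY|YX] := Ftot X Y FX FY.
    by exists Y => //; have [YL _] := FP Y FY; apply: YL => //; apply: XY.
  by exists X => //; have [XL _] := FP X FX; apply: XL => //; apply: YX.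
have I0 : I 0.
  apply: contrapT => nI0.
  have Iempty x : ~ I x.
    by move=> Ix; apply: nI0; rewrite -(addNr x) -mulN1r; apply: IL.
  apply: (Imax [set 0]); first split.
  - by move=> x /Iempty.
  - by move=> /(_ 0 erefl).
  - split=> [a u v -> ->|x Ux x0]; first by rewrite mulr0 addr0.
    by apply: U0; rewrite -x0.
have IM a u : I u -> I (a * u) by move=> Iu; rewrite -[a * u]addr0; apply: IL.
have ID u v : I u -> I v -> I (u + v).
  by move=> Iu Iv; rewrite -[u]mul1r; apply: IL.
(* By maximality, the ideal generated by I and u meets U. *)
have meets u : ~ I u -> exists a s, I a /\ U (a + s * u).
  move=> nIu; apply: contrapT => none.
  apply: (Imax [set x | exists a s, I a /\ x = a + s * u]); first split.
  - by move=> x Ix; exists x, 0; rewrite mul0r addr0.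
  - move=> /(_ u) sub; apply: nIu; apply: sub.
    by exists 0, 1; rewrite add0r mul1r.
  - split=> [a _ _ [a1 [s1 [Ia1 ->]]] [a2 [s2 [Ia2 ->]]]|x Ux [a [s [Ia xE]]]].
      exists (a * a1 + a2), (a * s1 + s2); split; first exact: IL.
      by ring.
    by apply: none; exists a, s; rewrite -xE.
have [||P PE] := @spec_of_set S I.
- split.
  + exact/asboolP.
  + by apply/asboolP => /(IU 1 U1).
  + by move=> a u v /asboolP Iu /asboolP Iv; apply/asboolP; apply: IL.
- move=> u v /asboolP Iuv; apply/orP.
  have [Iu|nIu] := pselect (I u); first by left; apply/asboolP.
  have [Iv|nIv] := pselect (I v); first by right; apply/asboolP.
  have [a [s [Ia Ua]]] := meets u nIu; have [b [t [Ib Ub]]] := meets v nIv.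
  case: (IU _ (UM _ _ Ua Ub)).
  have -> : (a + s * u) * (b + t * v) =
    (b + t * v) * a + ((s * u) * b + (s * t) * (u * v)) by ring.
  exact: ID _ _ (IM _ _ Ia) (ID _ _ (IM _ _ Ib) (IM _ _ Iuv)).
- by exists P => x Ux; apply/negP => /PE; apply: IU.
Qed.

Lemma spec_inhabited (S : comNzRingType) : inhabited (Spec S).
Proof.
have [||Q _] := @prime_avoiding S [set 1]; last by exists; exact: Q.
- by split=> // u v -> ->; rewrite mulr1.
- by move=> /esym/eqP; rewrite oner_eq0.
Qed.

Lemma nilpotent_of_primes (S : comNzRingType) (x : S) :
  (forall Q : Spec S, x \in Q) -> exists n, x ^+ n = 0.
Proof.
move=> xQ; apply: contrapT => nx.
have [||Q Qx] := @prime_avoiding S [set x ^+ n | n in [set: nat]].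
- split; first by exists 0%N.
  by move=> _ _ [i _ <-] [j _ <-]; exists (i + j)%N; rewrite ?exprD.
- by move=> [n _ xn]; apply: nx; exists n.
- have /negP := Qx x (ex_intro2 _ _ 1%N I (expr1 x)); exact.
Qed.

Lemma nilpotent_in_prime (S : comNzRingType) (x : S) n (Q : Spec S) :
  x ^+ n = 0 -> x \in Q.
Proof.
elim: n => [|n IH] xn.
  by have := oner_eq0 S; rewrite -[1]/(x ^+ 0) xn eqxx.
have : x ^+ n.+1 \in Q by rewrite xn idealr0.
rewrite exprS prime_idealrM => /orP[//|].
elim: n {IH xn} => [|n IH]; first by rewrite idealr1.
by rewrite exprS prime_idealrM => /orP[].
Qed.

(** * Artinian local rings and their residue field *)

Section ArtinianLocal.
Context (R : comNzRingType) (M : idealr R).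
Hypotheses (R_local : local_ring M) (R_artinian : artinian R).

(** The ideals (t ^ n) stabilize, so t ^ n * (1 - s * t) = 0 for some s. *)
Lemma artinian_inv_mod_prime (P : Spec R) t :
  t \notin P -> exists s, 1 - s * t \in P.
Proof.
move=> tP.
have [|n x [y ->]|N /(_ N.+1 (leqnSn N)) stat] :=
    @R_artinian (fun n => [set x | exists y, x = y * t ^+ n]).
- move=> n; split; first by apply/mem_set; exists 0; rewrite mul0r.
  move=> a u v /set_mem[y ->] /set_mem[z ->]; apply/mem_set.
  exists (a * y + z); rewrite mulrDl -mulrA; congr (_ + _); exact: scalerAl.
- by exists (y * t); rewrite exprS mulrA.
have [s tN] : [set x | exists y, x = y * t ^+ N.+1] (t ^+ N).
  by rewrite stat; exists 1; rewrite mul1r.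
exists s; have : t ^+ N * (1 - s * t) \in P.
  suff -> : t ^+ N * (1 - s * t) = 0 by rewrite idealr0.
  by rewrite mulrBr mulr1 {1}tN exprS; ring.
rewrite prime_idealrM => /orP[|//].
elim: (N) => [|n IH]; first by rewrite idealr1.
by rewrite exprS prime_idealrM (negPf tP).
Qed.

Lemma artinian_local_prime (P : Spec R) : P =i M.
Proof.
have [_] := R_local; apply => J PJ t; apply/idP/idP; last exact: PJ.
move=> tJ; apply/negPn/negP => /artinian_inv_mod_prime[s /PJ sJ].
have := idealr1 J; rewrite -(subrK (s * t) 1) rpredD //.
exact: idealMr.
Qed.

(** The set of all 1 - s * t is multiplicative; it meets the only prime M since
    t is invertible modulo M, so it contains 0. *)
Lemma local_unit t : t \notin M -> exists s, s * t = 1.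
Proof.
move=> tM; apply: contrapT => nt.
have [||P PU] := @prime_avoiding R [set x | exists s, x = 1 - s * t].
- split; first by exists 0; rewrite mul0r subr0.
  by move=> _ _ [a ->] [b ->]; exists (a + b - a * b * t); ring.
- by move=> [s /esym/eqP]; rewrite subr_eq0 => /eqP s1; apply: nt; exists s.
- have tP : t \notin P by rewrite artinian_local_prime.
  have [s sP] := artinian_inv_mod_prime tP.
  by have /negP := PU (1 - s * t) (ex_intro _ s erefl); apply.
Qed.

End ArtinianLocal.

Section Residue.
Context (R : comNzRingType) (M : idealr R) (S : comAlgType R).
Hypotheses (R_local : local_ring M) (R_artinian : artinian R).

Lemma alg_in_prime (Q : Spec S) r : (r%:A \in Q) = (r \in M).
Proof.
pose P := contract (GRing.in_alg S) Q.
by rewrite -(artinian_local_prime R_local R_artinian P).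
Qed.

(** Elementwise form of the condition that every residue field of S is that of
    R; this is what infra-integrality contributes to the proof. *)
Definition primes_rational : Prop :=
  forall (Q : Spec S) (x : S), exists r : R, x - r%:A \in Q.

(** The preimage of the class of x is a fraction of residues of R; since R is
    Artinian its denominator is invertible already in R modulo the contracted
    prime. *)
Lemma infra_integral_rational : infra_integral S -> primes_rational.
Proof.
move=> [_ kbij] Q x; have [kinv _ kK] := kbij Q.
pose f := GRing.in_alg S; pose P := contract f Q.
set y := kinv (to_residue_field Q x).
have [num numE] : exists b, residue_proj P b = \n_(repr y).
  by exists (repr (\n_(repr y) : residue_dom P)); rewrite residue_projK.
have [den denE] : exists b, residue_proj P b = \d_(repr y).
  by exists (repr (\d_(repr y) : residue_dom P)); rewrite residue_projK.
have den0 : residue_proj P den != 0 by rewrite denE; exact: denom_ratioP.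
have denQ : residue_proj Q (f den) != 0.
  by rewrite -residue_dom_mapE residue_dom_map_eq0.
have xE : x * f den - f num \in Q.
  rewrite -residue_proj_eq -tofrac_eq rmorphM tofracM.
  rewrite -[FracField.tofrac (residue_proj Q x)]/(to_residue_field Q x).
  rewrite -(kK (to_residue_field Q x)) -/y (fracE y) -numE -denE.
  by rewrite residue_map_frac // !residue_dom_mapE divfK // tofrac_eq0.
have denP : den \notin P by rewrite -[den]subr0 -residue_proj_eq rmorph0.
have [s sP] := artinian_inv_mod_prime R_artinian denP.
exists (s * num).
have -> : x - (s * num)%:A = x * f (1 - s * den) + f s * (x * f den - f num).
  have -> : (s * num)%:A = f s * f num := rmorphM (GRing.in_alg S) s num.
  by rewrite /f rmorphB rmorph1 rmorphM; ring.
by rewrite rpredD // idealMr.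
Qed.

End Residue.

(** * Subalgebras *)

Section Subalgebras.
Context (R : comNzRingType) (S : comAlgType R).

Lemma subalgP (A : set S) :
  subalg A <-> [/\ A 1, forall a u v, A u -> A v -> A (a *: u + v)
                 & forall u v, A u -> A v -> A (u * v)].
Proof.
split=> [] [A1 AL AM]; split.
- exact: set_mem.
- by move=> a u v uA vA; apply: set_mem; apply: AL; apply: mem_set.
- by move=> u v uA vA; apply: set_mem; apply: AM; apply: mem_set.
- exact: mem_set.
- by move=> a u v /set_mem uA /set_mem vA; apply: mem_set; apply: AL.
- by move=> u v /set_mem uA /set_mem vA; apply: mem_set; apply: AM.
Qed.

Section Closure.
Context (A : set S) (Asub : subalg A).

Lemma subalg1 : A 1. Proof. by have /subalgP[] := Asub. Qed.
Lemma subalgM u v : A u -> A v -> A (u * v).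
Proof. by have /subalgP[_ _] := Asub; apply. Qed.
Lemma subalgD u v : A u -> A v -> A (u + v).
Proof. by have /subalgP[_ AL _] := Asub; rewrite -{2}[u]scale1r; apply: AL. Qed.
Lemma subalg0 : A 0.
Proof.
have /subalgP[A1 AL _] := Asub.
by rewrite -(addNr 1) -scaleN1r; apply: AL.
Qed.
Lemma subalgZ a u : A u -> A (a *: u).
Proof.
have /subalgP[_ AL _] := Asub => Au.
by rewrite -[_ *: _]addr0; apply: AL => //; exact: subalg0.
Qed.
Lemma subalgB u v : A u -> A v -> A (u - v).
Proof.
by move=> Au Av; apply: subalgD => //; rewrite -scaleN1r; apply: subalgZ.
Qed.
Lemma subalgX u n : A u -> A (u ^+ n).
Proof.
move=> Au; elim: n => [|n IH]; first exact: subalg1.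
by rewrite exprS; apply: subalgM.
Qed.
Lemma subalgC r : A r%:A. Proof. by apply: subalgZ; exact: subalg1. Qed.
Lemma subalg_sum (I : finType) (F : I -> S) :
  (forall i, A (F i)) -> A (\sum_i F i).
Proof.
by move=> AF; apply: big_ind => //; [exact: subalg0|exact: subalgD].
Qed.

End Closure.

Lemma subalg_base : subalg (base_ring S).
Proof.
apply/subalgP; split; first by exists 1 => //; rewrite /= scale1r.
- move=> a _ _ [r _ <-] [s _ <-]; exists (a * r + s) => //=.
  by rewrite scalerDl scalerA.
- by move=> _ _ [r _ <-] [s _ <-]; exists (r * s); rewrite ?rmorphM.
Qed.

Lemma base_ring_sub (A : set S) : subalg A -> base_ring S `<=` A.
Proof. by move=> Asub _ [r _ <-]; apply: subalgC. Qed.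

Definition adjoin (x : S) : set S := range (horner_alg x).

Lemma subalg_adjoin x : subalg (adjoin x).
Proof.
apply/subalgP; split; first by exists 1; rewrite ?rmorph1.
- move=> a _ _ [p _ <-] [q _ <-]; exists (a *: p + q) => //.
  by rewrite linearP /= mulr_algl.
- by move=> _ _ [p _ <-] [q _ <-]; exists (p * q); rewrite ?rmorphM.
Qed.

Lemma adjoin_gen x : adjoin x x.
Proof. by exists 'X => //; rewrite horner_algX. Qed.

Lemma subalg_setI (A B : set S) : subalg A -> subalg B -> subalg (A `&` B).
Proof.
move=> Asub Bsub; apply/subalgP; split.
- by split; apply: subalg1.
- move=> a u v [Au Bu] [Av Bv].
  by split; apply: subalgD => //; apply: subalgZ.
- by move=> u v [Au Bu] [Av Bv]; split; apply: subalgM.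
Qed.

Lemma subalg_sub_horner (A : set S) x p :
  subalg A -> A x -> A (horner_alg x p).
Proof.
move=> Asub Ax; elim/poly_ind: p => [|p c IH].
  by rewrite rmorph0; apply: subalg0.
rewrite rmorphD rmorphM /= horner_algX horner_algC.
by apply: subalgD => //; [apply: subalgM|apply: subalgC].
Qed.

(** If all powers of x beyond the m-th lie in T and m > 0, then so do the square
    and the cube of x ^ m, hence x ^ m itself; descend from m = n to m = 0. *)
Lemma seminormal_nilpotent (T : set S) x n :
  subalg T -> seminormal T -> x ^+ n = 0 -> T x.
Proof.
move=> Tsub Tsn xn.
suff H m : (forall k, (m < k)%N -> T (x ^+ k)) -> T x.
  apply: (H n) => k nk; rewrite -(subnKC (ltnW nk)) exprD xn mul0r.
  exact: subalg0.
elim: m => [Tx|m IH Tx]; first by have := Tx 1%N isT; rewrite expr1.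
apply: IH => k; rewrite leq_eqVlt => /orP[/eqP <-|]; last exact: Tx.
by apply: Tsn; rewrite -exprM; apply: Tx; lia.
Qed.

End Subalgebras.

(** * Separating a subalgebra into idempotents and nilpotents *)

Section Decomposition.
Context (R : comNzRingType) (M : idealr R) (S : comAlgType R).
Hypotheses (R_local : local_ring M) (R_artinian : artinian R).
Hypothesis S_rat : primes_rational S.

(** Products of factors x - r form a multiplicative set; each prime contains one
    of these factors. *)
Lemma rational_split (x : S) :
  exists s : seq R, \prod_(r <- s) (x - r%:A) = 0.
Proof.
apply: contrapT => ns.
have [||Q QU] :=
  @prime_avoiding S (range (fun s : seq R => \prod_(r <- s) (x - r%:A))).
- split; first by exists [::] => //; rewrite big_nil.
  by move=> _ _ [s _ <-] [t _ <-]; exists (s ++ t) => //; rewrite big_cat.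
- by move=> [s _ sE]; apply: ns; exists s.
- have [r xr] := S_rat Q x.
  have /negP[] : x - r%:A \notin Q.
    by apply: QU; exists [:: r] => //; rewrite big_seq1.
  by [].
Qed.

(** The elements u ^ n * (1 - u * w) with w in A form a multiplicative set.  A
    prime Q avoiding it would not contain u, so u would be congruent modulo Q
    to a scalar that is invertible modulo Q, with inverse s, say; but then
    1 - u * s would lie in Q. *)
Lemma strongly_pi_regular (A : set S) u : subalg A -> A u ->
  exists n w, A w /\ u ^+ n * (1 - u * w) = 0.
Proof.
move=> Asub Au; apply: contrapT => nu.
have [||Q QU] := @prime_avoiding S
  [set z | exists n w, A w /\ z = u ^+ n * (1 - u * w)].
- split; first exists 0%N, 0.
    by split; [exact: subalg0|rewrite mulr0 subr0 mulr1].
  move=> _ _ [i [v [Av ->]]] [j [w [Aw ->]]].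
  exists (i + j)%N, (v + w - u * v * w); rewrite exprD; split; last by ring.
  by apply: subalgB => //; [apply: subalgD|do ![apply: subalgM => //]].
- by move=> [n [w [Aw e]]]; apply: nu; exists n, w.
have uQ : u \notin Q.
  apply: QU; exists 1%N, 0; split; first exact: subalg0.
  by rewrite mulr0 subr0 mulr1.
have [r ur] := S_rat Q u.
have rP : r \notin contract (GRing.in_alg S) Q.
  by apply: contra uQ => rP; rewrite -(subrK r%:A u) rpredD.
have [s sP] := artinian_inv_mod_prime R_artinian rP.
have /negP[] : 1 - u * s%:A \notin Q.
  by apply: QU; exists 0%N, s%:A; split; [exact: subalgC|rewrite mul1r].
have -> : 1 - u * s%:A = (1 - s * r)%:A - s%:A * (u - r%:A).
  have -> : (1 - s * r)%:A = 1 - s%:A * r%:A :> S.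
    by rewrite -[LHS]/(GRing.in_alg S _) rmorphB rmorph1 rmorphM.
  by ring.
by apply: rpredB; [exact: sP|exact: idealMr].
Qed.

(** On the part of S cut out by e the element u is invertible, on the part cut
    out by 1 - e it is nilpotent. *)
Lemma fitting_idempotent (A : set S) u : subalg A -> A u ->
  exists n e v, [/\ A e, A v, e * e = e, u ^+ n * (1 - e) = 0 & e = u * v].
Proof.
move=> Asub Au; have [n [w [Aw unw]]] := strongly_pi_regular Asub Au.
have uE : u ^+ n = u ^+ n * (u * w).
  by move/eqP: unw; rewrite mulrBr mulr1 subr_eq0 => /eqP.
have uX k : u ^+ n = u ^+ n * (u * w) ^+ k.
  by elim: k => [|k IH]; rewrite ?mulr1 // exprS mulrA -uE.
have unE : u ^+ n.+1 = u ^+ n.+1 * (u * w) ^+ n.+1.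
  by rewrite exprS -mulrA -uX.
exists n.+1, ((u * w) ^+ n.+1), (w * (u * w) ^+ n); split.
- by apply: subalgX => //; apply: subalgM.
- by apply: subalgM => //; apply: subalgX => //; apply: subalgM.
- by rewrite {1}exprMn {1}(mulrC (u ^+ _)) -mulrA -unE exprMn mulrC.
- by rewrite mulrBr mulr1 -unE subrr.
- by rewrite exprS mulrA.
Qed.

(** Each x in A is an R-combination of idempotents of A plus a nilpotent of A.
    Induct on the number of factors in a relation prod (x - r_j) = 0, relative
    to an idempotent e of A: the Fitting idempotent f of u = x - r splits e into
    e * (1 - f), where x is r plus a nilpotent, and e * f, where u is invertible
    and so can be cancelled from the relation. *)
Lemma sub_of_idempotents_nilpotents (A B : set S) : subalg A -> subalg B ->
    (forall e, A e -> e * e = e -> B e) ->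
    (forall v n, A v -> v ^+ n = 0 -> B v) ->
  A `<=` B.
Proof.
move=> Asub Bsub Bidem Bnil x Ax.
have [s sx] := rational_split x.
suff H e : A e -> e * e = e -> e * \prod_(r <- s) (x - r%:A) = 0 -> B (e * x).
  by rewrite -[x]mul1r; apply: H; rewrite ?mul1r //; exact: subalg1.
elim: s {sx} e => [|r s IH] e Ae ee.
  by rewrite big_nil mulr1 => ->; rewrite mul0r; apply: subalg0.
rewrite big_cons; set u := x - r%:A; set g := \prod_(_ <- _) _ => egx.
have Au : A u by apply: subalgB => //; apply: subalgC.
have [n [f [v [Af Av ff unf fE]]]] := fitting_idempotent Asub Au.
have Aef : A (e * (1 - f)).
  by apply: subalgM => //; apply: subalgB => //; exact: subalg1.
have efef : e * (1 - f) * (e * (1 - f)) = e * (1 - f).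
  transitivity (e * e * (1 - f - f + f * f)); first by ring.
  by rewrite ee ff; ring.
have -> : e * x = r%:A * (e * (1 - f)) + e * (1 - f) * u + e * f * x.
  by rewrite /u; ring.
apply: subalgD => //; first apply: subalgD => //.
- by apply: subalgM; [|exact: subalgC|exact: Bidem].
- apply: (Bnil _ n.+1); first exact: subalgM.
  rewrite exprMn exprSr [u ^+ n.+1]exprS -!mulrA.
  have -> : (1 - f) * (u * u ^+ n) = u * (u ^+ n * (1 - f)) by ring.
  by rewrite unf !mulr0.
- apply: IH; first exact: subalgM.
    by transitivity (e * e * (f * f)); [ring|rewrite ee ff].
  rewrite -/g {1}fE; transitivity (v * (e * (u * g))); first by ring.
  by rewrite egx mulr0.
Qed.

Lemma prime_prod (Q : Spec S) (I : eqType) (s : seq I) (F : I -> S) :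
  \prod_(i <- s) F i \in Q -> exists2 i, i \in s & F i \in Q.
Proof.
elim: s => [|i s IH]; first by rewrite big_nil idealr1.
rewrite big_cons prime_idealrM => /orP[Fi|/IH[j js Fj]].
  by exists i; rewrite ?mem_head.
by exists j; rewrite // inE js orbT.
Qed.

(** Attach to e the set of all systems of roots of the generators that occur at
    a prime containing e.  This code determines which primes contain e, and two
    idempotents lying in the same primes are equal. *)
Lemma idempotents_finite : module_finite S ->
  exists (I : finType) (code : S -> I), forall e f,
    e * e = e -> f * f = f -> code e = code f -> e = f.
Proof.
move=> [n [g gen]].
have [roots rootsP] := choice (fun l => rational_split (g l)).
pose k := (\max_l size (roots l))%N.
pose J : finType := {ffun 'I_n -> 'I_k}.
pose at_root (Q : Spec S) (j : J) :=
  forall l, g l - (nth 0 (roots l) (j l))%:A \in Q.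
have rootE (Q : Spec S) : exists j, at_root Q j.
  have index_l l : exists i : 'I_k, g l - (nth 0 (roots l) i)%:A \in Q.
    have [|r rs rQ] := @prime_prod Q _ (roots l) (fun r => g l - r%:A).
      by rewrite rootsP idealr0.
    have lk : (index r (roots l) < k)%N.
      rewrite -index_mem in rs; apply: leq_trans rs _.
      exact: (leq_bigmax l).
    by exists (Ordinal lk); rewrite /= nth_index.
  have [j jP] := choice index_l.
  by exists [ffun l => j l] => l; rewrite ffunE.
(* The roots of the generators determine the prime: modulo Q, x is the scalar *)
(* b below, which is computed from j alone.                                   *)
have rootI (Q Q' : Spec S) j x :
    at_root Q j -> at_root Q' j -> x \in Q -> x \in Q'.
  have [c ->] := gen x => jQ jQ'.
  pose b := \sum_l c l * nth 0 (roots l) (j l).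
  have mod_b (P : Spec S) : at_root P j -> \sum_l c l *: g l - b%:A \in P.
    move=> jP; rewrite /b scaler_suml -sumrB; apply: rpred_sum => l _.
    by rewrite -scalerA -scalerBr -[X in X \in _]mulr_algl idealMr.
  move=> xQ; rewrite -(subrK b%:A (\sum_l _)) rpredD ?mod_b //.
  have algM := alg_in_prime R_local R_artinian; rewrite algM -(algM _ Q).
  by rewrite -[b%:A](subKr (\sum_l c l *: g l)) rpredB ?mod_b.
pose code e : {set J} :=
  [set j | `[< exists Q : Spec S, at_root Q j /\ e \in Q >]]%SET.
have code_sub e f (Q : Spec S) : code e = code f -> e \in Q -> f \in Q.
  move=> ef eQ; have [j jQ] := rootE Q.
  have : j \in code e by rewrite inE; apply/asboolP; exists Q.
  by rewrite ef inE => /asboolP[Q' [jQ' fQ']]; apply: rootI fQ'.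
(* The idempotent e * (1 - f) lies in every prime, so it is nilpotent. *)
have absorb e f : e * e = e -> f * f = f -> code e = code f -> e = e * f.
  move=> ee ff ef.
  have [m em] : exists m, (e * (1 - f)) ^+ m = 0.
    apply: nilpotent_of_primes => Q.
    have : f * (1 - f) \in Q by rewrite mulrBr mulr1 ff subrr idealr0.
    rewrite !prime_idealrM => /orP[/(code_sub _ _ _ (esym ef)) ->//|->].
    by rewrite orbT.
  have idem : e * (1 - f) * (e * (1 - f)) = e * (1 - f).
    by transitivity (e * e * (1 - f - f + f * f)); [ring|rewrite ee ff; ring].
  have ef0 : e * (1 - f) = 0.
    have idemX i : (e * (1 - f)) ^+ i.+1 = e * (1 - f).
      by elim: i => [|i IH]; rewrite ?expr1 // exprS IH idem.
    by rewrite -(idemX m) exprS em mulr0.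
  by apply/eqP; rewrite -subr_eq0 -{1}[e]mulr1 -mulrBr ef0.
exists {set J}, code => e f ee ff ef.
by rewrite (absorb e f) // [RHS](absorb f e) // mulrC.
Qed.

(** T contains the nilpotents of S, so a subalgebra A is determined by its
    idempotents together with its intersection with T. *)
Lemma FIP_of_seminormal (T : set S) : module_finite S ->
  subalg T -> seminormal T -> FIP T -> FIP [set: S].
Proof.
move=> Sfin Tsub Tsn Tfip.
have [I [code codeI]] := idempotents_finite Sfin.
pose idem (A : set S) : {set I} :=
  [set i | `[< exists e, [/\ A e, e * e = e & code e = i] >]]%SET.
pose inv (A : set S) := (A `&` T, idem A).
have invS A B : subalg A -> subalg B -> inv A = inv B -> A `<=` B.
  move=> Asub Bsub [ABT ABi].
  apply: sub_of_idempotents_nilpotents => // [e Ae ee|v n Av vn].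
    have : code e \in idem A by rewrite inE; apply/asboolP; exists e.
    rewrite ABi inE => /asboolP[f [Bf ff fe]].
    by rewrite -(codeI f e).
  have : (A `&` T) v by split=> //; apply: (seminormal_nilpotent Tsub Tsn vn).
  by rewrite ABT => -[].
have inv_inj : {in intermediate [set: S] &, injective inv}.
  move=> A B /set_mem[Asub _] /set_mem[Bsub _] AB.
  by apply/seteqP; split; apply: invS.
rewrite /FIP -(eq_finite_set (inj_card_eq inv_inj)).
apply: (sub_finite_set _ (finite_setX Tfip (@finite_finset _ [set: {set I}]))).
move=> _ [A [Asub _] <-]; split=> //=; split; last exact: subIsetr.
exact: subalg_setI.
Qed.

End Decomposition.

(** * Chains of subalgebras in the subintegral case *)

Section Chains.
Context (R : comNzRingType) (M : idealr R) (S : comAlgType R).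
Hypotheses (R_local : local_ring M) (R_artinian : artinian R).

Let pi : {rmorphism R -> {ideal_quot M}} := \pi_{ideal_quot M}%qT.

Lemma pi_eq0 r : (pi r == 0) = (r \in M).
Proof. by rewrite -(rmorph0 pi) -[r in RHS]subr0 Quotient.idealrBE. Qed.

Lemma residue_unitX r n : r \notin M -> pi r ^+ n != 0.
Proof.
move=> /(local_unit R_local R_artinian)[s sr].
apply/eqP => rn; have := oner_neq0 {ideal_quot M}.
have : pi s * pi r = 1 by rewrite -rmorphM sr rmorph1.
move=> /(congr1 (fun z => z ^+ n)).
by rewrite expr1n exprMn rn mulr0 => <-; rewrite eqxx.
Qed.

(** The first powers of p(c) are expressed through those of c by a matrix which
    modulo M is upper triangular with diagonal entries the powers of the unit
    p`_1.  It is invertible over R, so c is a combination of powers of p(c). *)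
Lemma mem_generator (A : set S) (c : S) n (p : {poly R}) :
    subalg A -> c ^+ n = 0 -> A (horner_alg c p) ->
    p`_0 \in M -> p`_1 \notin M ->
  A c.
Proof.
move=> Asub cn Ap p0 p1.
(* n.+2 rather than n, so that c itself is among the powers c ^ j, j < m *)
pose m := n.+2.
pose T : 'M[R]_m := \matrix_(i, j) (p ^+ i)`_j.
have powE i : horner_alg c p ^+ i = \sum_(j < m) (p ^+ i)`_j *: c ^+ j.
  have cm : c ^+ m = 0 by rewrite /m -addn2 exprD cn mul0r.
  rewrite -rmorphXn /= -[p ^+ i in LHS](poly_take_drop m) rmorphD rmorphM /=.
  rewrite rmorphXn /= horner_algX cm mulr0 addr0.
  rewrite /take_poly poly_def rmorph_sum /=; apply: eq_bigr => j _.
  by rewrite linearZ /= rmorphXn /= horner_algX mulr_algl.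
have pi0 : pi p`_0 = 0 by apply/eqP; rewrite pi_eq0.
have [q pq] : exists q, map_poly pi p = 'X * (q * 'X + (pi p`_1)%:P).
  exists (drop_poly 2 (map_poly pi p)).
  apply/polyP => -[|[|i]]; rewrite coef_map coefXM // coefD coefMX coefC /=.
    by rewrite add0r.
  by rewrite addr0 coef_drop_poly coef_map addn2.
have piT (i j : 'I_m) : pi (T i j) = (('X * (q * 'X + (pi p`_1)%:P)) ^+ i)`_j.
  by rewrite mxE -pq -rmorphXn coef_map.
have detT : \det T \notin M.
  rewrite -pi_eq0 -det_map_mx -det_tr det_trig.
    rewrite (eq_bigr (fun i : 'I_m => pi p`_1 ^+ i)) => [|i _]; last first.
      rewrite 2!mxE piT exprMn coefXnM ltnn subnn -horner_coef0.
      by rewrite horner_exp !hornerE.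
    by rewrite prodrXr residue_unitX.
  apply/is_trig_mxP => i j ij.
  by rewrite 2!mxE piT exprMn coefXnM ij.
have [s sT] := local_unit R_local R_artinian detT.
pose k : 'I_m := @Ordinal m 1 isT.
have -> : c = \sum_(i < m) (s * (\adj T) k i) *: horner_alg c p ^+ i.
  transitivity (\sum_(j < m) (s * (\adj T *m T) k j) *: c ^+ j).
    rewrite mul_adj_mx (bigD1 k) //= big1 => [|j jk].
      by rewrite mxE eqxx mulr1n sT scale1r addr0 expr1.
    by rewrite mxE eq_sym (negPf jk) mulr0n mulr0 scale0r.
  under [RHS]eq_bigr => i _ do rewrite powE scaler_sumr.
  rewrite exchange_big /=; apply: eq_bigr => j _.
  rewrite mxE mulr_sumr scaler_suml; apply: eq_bigr => i _.
  by rewrite scalerA [T i j]mxE mulrA.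
by apply: subalg_sum => // i; apply: subalgZ => //; apply: subalgX.
Qed.

(** Contraction is injective and all primes of R equal M, so S has one prime,
    whose elements are nilpotent. *)
Lemma subintegral_nilpotent : subintegral S ->
  forall x : S, exists r n, (x - r%:A) ^+ n = 0.
Proof.
move=> [Sinf Sbij] x.
have Srat := infra_integral_rational R_artinian Sinf.
have [N] := spec_inhabited S.
have [r rN] := Srat N x.
exists r; apply: nilpotent_of_primes => Q.
have -> // : Q = N.
apply: (bij_inj Sbij); apply: spec_ext => t.
by rewrite !(artinian_local_prime R_local R_artinian).
Qed.

(** With a = p(c) and b = q(c), where c = a + r b: if p`_1 or q`_1 is a unit, c
    lies in A or in B by [mem_generator].  Otherwise the polynomial p + r q - X
    has unit linear coefficient and vanishes at c, so [mem_generator] puts c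
    into R itself. *)
Lemma adjoin_line_disjunction (A B : set S) a b r n m l :
    subalg A -> subalg B -> A a -> B b -> a ^+ n = 0 -> b ^+ m = 0 ->
    (a + r *: b) ^+ l = 0 ->
    adjoin (a + r *: b) a -> adjoin (a + r *: b) b ->
  B a \/ A b.
Proof.
set c := a + r *: b => Asub Bsub Aa Bb an bm cl [p _ pa] [q _ qb].
have [Q] := spec_inhabited S.
have const_coef f x k : horner_alg c f = x -> x ^+ k = 0 -> f`_0 \in M.
  move=> fx xk.
  rewrite -(alg_in_prime R_local R_artinian Q).
  have : x - horner_alg c (drop_poly 1 f) * c \in Q.
    by rewrite rpredB ?idealMr // (nilpotent_in_prime _ xk,
      nilpotent_in_prime _ cl).
  rewrite -fx -{1}(poly_take_drop 1 f) rmorphD rmorphM /= horner_algX addrK.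
  by rewrite /take_poly poly_def big_ord1 expr0 alg_polyC horner_algC.
have [p1|p1] := boolP (p`_1 \in M); last first.
  right; rewrite -qb; apply: subalg_sub_horner => //.
  apply: (mem_generator Asub cl _ _ p1); first by rewrite pa.
  exact: const_coef pa an.
have [q1|q1] := boolP (q`_1 \in M); last first.
  left; rewrite -pa; apply: subalg_sub_horner => //.
  apply: (mem_generator Bsub cl _ _ q1); first by rewrite qb.
  exact: const_coef qb bm.
left; rewrite -pa; apply: subalg_sub_horner => //; apply: (base_ring_sub Bsub).
pose f := p + r *: q - 'X.
have f0 : horner_alg c f = 0.
  by rewrite /f -mul_polyC rmorphB rmorphD rmorphM /= horner_algX horner_algC
    mulr_algl pa qb subrr.
apply: (@mem_generator _ c l f (@subalg_base _ _)) => //.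
- by rewrite f0; apply: subalg0; apply: subalg_base.
- by rewrite !coefE subr0 rpredD ?idealMr // (const_coef _ _ _ pa an,
    const_coef _ _ _ qb bm).
- rewrite !coefE /=; apply: contraFN (idealr1 M) => fM.
  by rewrite -(subKr (p`_1 + r * q`_1) 1) rpredB // rpredD ?idealMr.
Qed.

(** By the pigeonhole principle R[a + r b] = R[a + r' b] for two scalars whose
    difference is a unit; this algebra contains b, hence a. *)
Lemma FIP_line (a b : S) : infinite_set [set: {ideal_quot M}] ->
    FIP [set: S] ->
  exists r, adjoin (a + r *: b) a /\ adjoin (a + r *: b) b.
Proof.
move=> Minf Sfip.
pose line (z : {ideal_quot M}) := adjoin (a + repr z *: b).
have [z [w [zw lzw]]] : exists z w, z != w /\ line z = line w.
  apply: contrapT => nzw; apply: Minf.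
  have line_inj : {in [set: {ideal_quot M}] &, injective line}.
    move=> z w _ _ zw; apply: contrapT => /eqP nz.
    by apply: nzw; exists z, w.
  rewrite -(eq_finite_set (inj_card_eq line_inj)).
  apply: sub_finite_set Sfip => _ [z _ <-].
  by split=> //; exact: subalg_adjoin.
have [s sr] : exists s, s * (repr z - repr w) = 1.
  apply: (local_unit R_local R_artinian).
  by rewrite Quotient.idealrBE !reprK.
exists (repr z); rewrite -/(line z).
have zsub : subalg (line z) by exact: subalg_adjoin.
have zz : line z (a + repr z *: b) by exact: adjoin_gen.
have zw' : line z (a + repr w *: b) by rewrite lzw; exact: adjoin_gen.
have zb : line z b.
  rewrite -[b]scale1r -sr -scalerA; apply: subalgZ => //.
  have -> : (repr z - repr w) *: b = a + repr z *: b - (a + repr w *: b).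
    by rewrite scalerBl opprD addrACA subrr add0r.
  exact: subalgB.
split=> //; rewrite -(addrK (repr z *: b) a).
by apply: subalgB => //; apply: subalgZ.
Qed.

Lemma subintegral_FIP_chain : infinite_set [set: {ideal_quot M}] ->
    FIP [set: S] -> subintegral S ->
  forall A B : set S, subalg A -> subalg B -> A `<=` B \/ B `<=` A.
Proof.
move=> Minf Sfip Ssub A B Asub Bsub.
apply: contrapT => /not_orP[AB BA].
have /existsNP[a /not_implyP[Aa nBa]] := AB.
have /existsNP[b /not_implyP[Bb nAb]] := BA.
have nilp := subintegral_nilpotent Ssub.
have [ra [n an]] := nilp a; have [rb [m bm]] := nilp b.
set a' := a - ra%:A in an; set b' := b - rb%:A in bm.
have [r [ca cb]] := FIP_line a' b' Minf Sfip.
have [l cl] : exists l, (a' + r *: b') ^+ l = 0.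
  apply: nilpotent_of_primes => Q.
  rewrite -mulr_algl rpredD ?idealMr //.
    exact: nilpotent_in_prime an.
  exact: nilpotent_in_prime bm.
have [||Ba|Ab] := adjoin_line_disjunction Asub Bsub _ _ an bm cl ca cb.
- by apply: subalgB => //; exact: subalgC.
- by apply: subalgB => //; exact: subalgC.
- by apply: nBa; rewrite -(subrK ra%:A a); apply: subalgD => //; exact: subalgC.
- by apply: nAb; rewrite -(subrK rb%:A b); apply: subalgD => //; exact: subalgC.
Qed.

End Chains.

(** * The three claims *)

Theorem proposition1p6 (R : comNzRingType) (M : idealr R) (S : comAlgType R)
  (R_local : local_ring M) (R_artinian : artinian R)
  (RM_infinite : infinite_set [set: {ideal_quot M}])
  (RS_ext : ring_extension S) :
  [/\ proper_extension S -> FIP [set: S] -> subintegral S ->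
        forall A B : set S, intermediate [set: S] A ->
          intermediate [set: S] B -> A `<=` B \/ B `<=` A,
      module_finite S -> seminormal (base_ring S) -> infra_integral S ->
        FIP [set: S]
    & proper_extension S -> module_finite S -> infra_integral S ->
        (FIP [set: S] <-> FIP (seminormalization S))].
Proof.
split.
- move=> _ Sfip Ssub A B [Asub _] [Bsub _].
  exact: (subintegral_FIP_chain R_local).
- move=> Sfin Rsn Sinf.
  apply: (FIP_of_seminormal R_local R_artinian
    (infra_integral_rational R_artinian Sinf) Sfin (@subalg_base _ _) Rsn).
  apply: (@sub_finite_set _ _ [set base_ring S]); last exact: finite_set1.
  by move=> A [Asub AR]; apply/seteqP; split=> //; exact: base_ring_sub.
- move=> _ Sfin Sinf; have [Tsub Tsn _] := seminormalizationP S.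
  split=> [Sfip|]; first by apply: sub_finite_set Sfip => A [Asub _].
  exact: (FIP_of_seminormal R_local R_artinian
    (infra_integral_rational R_artinian Sinf)).
Qed.
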